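(* Let $b\ge2$ and $p\ge1$ be integers. As an identity of rational functions of $z$, \[ \sum_{n=1}^{b^p-1}s_{b}(n)z^{n}=\frac{1-z^{b^{p}}}{1-z}\sum_{l=0}^{p-1}\frac{z^{b^{l}}-bz^{b^{l+1}}+(b-1)z^{(b+1)b^{l}}}{\left(1-z^{b^{l}}\right)\left(1-z^{b^{l+1}}\right)}. \] In particular, for $b=2$, \[ \sum_{n=1}^{2^p-1}s_{2}(n)z^{n}=\frac{1-z^{2^{p}}}{1-z}\sum_{l=0}^{p-1}\frac{z^{2^{l}}}{1+z^{2^{l}}}. \]
   Context: $s_b(n)$ is the sum of the base-$b$ digits of $n$. *)

(* Defs.v *)
From mathcomp Require Import all_boot all_order all_algebra.

Set Implicit Arguments.
Unset Strict Implicit.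
Unset Printing Implicit Defensive.

Definition digit (b n i : nat) : nat := (n %/ b ^ i) %% b.

(* For 1 < b and 0 < n, the base-b expansion of n has exactly
   (trunc_log b n).+1 digits; for n = 0 the only summand is the digit 0. *)
Definition digit_sum (b n : nat) : nat :=
  \sum_(i < (trunc_log b n).+1) digit b n i.

Definition fracX (F : fieldType) : {fraction {poly F}} := tofrac 'X%R.

(* Main.v *)
(** Every [n < b ^ p.+1] is uniquely [d * b ^ p + r] with [d < b] and
    [r < b ^ p], and then [s_b n = d + s_b r].  Hence, with [y = z ^ (b ^ p)],
    the polynomial [S p = \sum_(0 <= n < b ^ p) s_b n * z ^ n] satisfies
    [S p.+1 = (\sum_(d < b) y ^ d) * S p
              + (\sum_(d < b) d * y ^ d) * (1 - y) / (1 - z)],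
    and dividing by [(1 - z ^ (b ^ p.+1)) / (1 - z)] turns this recurrence into
    a telescoping one. *)
Require Import Defs.
From mathcomp Require Import all_boot all_order all_algebra.
From mathcomp Require Import ring.
Import GRing.Theory.

Set Implicit Arguments.
Unset Strict Implicit.
Unset Printing Implicit Defensive.

Local Open Scope ring_scope.

(** At a position [i >= p] the digit vanishes because [n < b ^ p <= b ^ i]. This frees [digit_sum]
    from its [trunc_log] bound. *)
Lemma sum_digit_widen (b n p q : nat) :
  (0 < b)%N -> (n < b ^ p)%N -> (p <= q)%N ->
  (\sum_(0 <= i < q) digit b n i = \sum_(0 <= i < p) digit b n i)%N.
Proof.
move=> b_gt0 n_lt le_pq; rewrite (big_cat_nat (leq0n p) le_pq) /=.
rewrite [X in (_ + X)%N]big_nat_cond [X in (_ + X)%N]big1 ?addn0 // => i.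
rewrite andbT => /andP[le_pi _].
by rewrite /digit divn_small ?mod0n // (leq_trans n_lt) // leq_pexp2l.
Qed.

Lemma digit_sumE (b n p : nat) : (1 < b)%N -> (n < b ^ p)%N ->
  digit_sum b n = (\sum_(0 <= i < p) digit b n i)%N.
Proof.
move=> b_gt1 n_lt; have b_gt0 := ltnW b_gt1.
have n_lt_log := trunc_log_ltn n b_gt1.
rewrite /digit_sum -(big_mkord xpredT (digit b n)).
(* Both bounds exceed every nonzero digit position, so the longer sum reduces to the shorter,
   whichever that is. *)
by case: (leqP p (trunc_log b n).+1) => [|/ltnW] le_pq;
  [|symmetry]; apply: sum_digit_widen.
Qed.

Lemma digit_sum_lead (b p d r : nat) : (1 < b)%N -> (d < b)%N -> (r < b ^ p)%N ->
  digit_sum b (d * b ^ p + r) = (d + digit_sum b r)%N.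
Proof.
move=> b_gt1 d_lt r_lt; have b_gt0 := ltnW b_gt1.
have n_lt : (d * b ^ p + r < b ^ p.+1)%N.
  rewrite expnS (@leq_trans (d.+1 * b ^ p)) ?leq_mul2r ?d_lt ?orbT //.
  by rewrite mulSn addnC ltn_add2r.
rewrite (digit_sumE b_gt1 n_lt) (digit_sumE b_gt1 r_lt) big_nat_recr //= addnC.
congr (_ + _)%N.
  by rewrite /digit divnMDl ?expn_gt0 ?b_gt0 // divn_small // addn0 modn_small.
apply: eq_big_nat => i /= lt_ip.
(* Since [i < p], the block [d * b ^ p] adds a multiple of [b] to the quotient by [b ^ i], leaving
   digit [i] unchanged. *)
have ->: (b ^ p = b ^ (p - i).-1 * b * b ^ i)%N.
  by rewrite -expnSr -expnD prednK ?subn_gt0 // subnK // ltnW.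
by rewrite /digit !mulnA divnMDl ?expn_gt0 ?b_gt0 // modnMDl.
Qed.

Lemma digit_sum0 (b : nat) : (1 < b)%N -> digit_sum b 0 = 0%N.
Proof. by move=> b_gt1; rewrite (@digit_sumE b 0 0) // big_geq. Qed.

Section GeometricSums.

Variable K : fieldType.
Implicit Type y : K.

Lemma sum_geometric y n : y != 1 ->
  \sum_(0 <= i < n) y ^+ i = (1 - y ^+ n) / (1 - y).
Proof.
move=> y_neq1; have y1_neq0 : 1 - y != 0 by rewrite subr_eq0 eq_sym.
elim: n => [|n IHn]; first by rewrite big_geq // expr0 subrr mul0r.
by rewrite big_nat_recr //= IHn exprS; field.
Qed.

Lemma sum_arith_geometric y n : y != 1 ->
  \sum_(0 <= i < n) i%:R * y ^+ i
    = (y - n%:R * y ^+ n + (n%:R - 1) * y ^+ n.+1) / (1 - y) ^+ 2.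
Proof.
move=> y_neq1; have y1_neq0 : 1 - y != 0 by rewrite subr_eq0 eq_sym.
elim: n => [|n IHn].
  by rewrite big_geq // expr1 mul0r subr0 sub0r mulN1r subrr mul0r.
by rewrite big_nat_recr //= IHn -natr1 !exprS; field.
Qed.

End GeometricSums.

Section DigitSumSeries.

Variables (K : fieldType) (z : K).
(** The only property of the indeterminate that is needed: it keeps all denominators nonzero. *)
Hypothesis z_free : forall n, (0 < n)%N -> z ^+ n != 1.

Let sub_neq0 n : (0 < n)%N -> 1 - z ^+ n != 0.
Proof. by move=> n_gt0; rewrite subr_eq0 eq_sym z_free. Qed.

Lemma digit_sum_series_rec (b p : nat) : (1 < b)%N ->
  let y := z ^+ (b ^ p)%N in
  \sum_(0 <= n < (b ^ p.+1)%N) (digit_sum b n)%:R * z ^+ n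
  = (\sum_(0 <= d < b) y ^+ d)
      * (\sum_(0 <= n < (b ^ p)%N) (digit_sum b n)%:R * z ^+ n)
    + (\sum_(0 <= d < b) d%:R * y ^+ d) * (\sum_(0 <= n < (b ^ p)%N) z ^+ n).
Proof.
move=> b_gt1 y; rewrite expnS big_nat_mul !mulr_suml -big_split /=.
apply: eq_big_nat => d /= d_lt.
(* The block of indices with leading digit [d] is shifted to start at 0, so its index becomes the
   remainder [r]. *)
rewrite mulSn -{1}[(d * _)%N]add0n big_addn addnK !mulr_sumr -big_split /=.
apply: eq_big_nat => r /= r_lt.
rewrite addnC digit_sum_lead // natrD exprD mulnC exprM -/y; ring.
Qed.

Lemma digit_sum_series (b p : nat) : (1 < b)%N ->
  \sum_(1 <= n < (b ^ p)%N) (digit_sum b n)%:R * z ^+ n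
  = (1 - z ^+ (b ^ p)%N) / (1 - z)
    * \sum_(0 <= l < p)
        (z ^+ (b ^ l)%N - b%:R * z ^+ (b ^ l.+1)%N
           + (b%:R - 1) * z ^+ ((b + 1) * b ^ l)%N)
        / ((1 - z ^+ (b ^ l)%N) * (1 - z ^+ (b ^ l.+1)%N)).
Proof.
move=> b_gt1; have bX_gt0 l : (0 < b ^ l)%N by rewrite expn_gt0 ltnW.
have z_neq1 : z != 1 by rewrite -[z]expr1 z_free.
have z1_neq0 : 1 - z != 0 by rewrite subr_eq0 eq_sym.
(* The term at 0 is zero; including it makes the range split into [b] full blocks. *)
suff <-: \sum_(0 <= n < (b ^ p)%N) (digit_sum b n)%:R * z ^+ n
         = \sum_(1 <= n < (b ^ p)%N) (digit_sum b n)%:R * z ^+ n.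
  elim: p => [|p IHp].
    by rewrite big_nat1 digit_sum0 // mul0r [X in _ * X]big_geq // mulr0.
  rewrite digit_sum_series_rec // IHp big_nat_recr //=.
  have y1_neq0 := sub_neq0 (bX_gt0 p); have yb1_neq0 := sub_neq0 (bX_gt0 p.+1).
  rewrite !sum_geometric ?sum_arith_geometric ?z_free //.
  (* With [y = z ^+ (b ^ p)], the other powers become [y ^+ b] and [y ^+ b.+1], leaving a rational
     identity in [z], [y] and [y ^+ b]. *)
  rewrite addn1 mulnC [(b ^ p.+1)%N]expnSr !exprM in yb1_neq0 *.
  by rewrite [_ ^+ b.+1]exprS; field; apply/and3P.
by rewrite [LHS]big_ltn // digit_sum0 // mul0r add0r.
Qed.

(** For [b = 2] the numerator is [y - 2 y^2 + y^3 = y (1 - y)^2] and the denominator is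
    [(1 - y)^2 (1 + y)]. *)
Lemma digit_sum_series2 (p : nat) :
  \sum_(1 <= n < (2 ^ p)%N) (digit_sum 2 n)%:R * z ^+ n
  = (1 - z ^+ (2 ^ p)%N) / (1 - z)
    * \sum_(0 <= l < p) z ^+ (2 ^ l)%N / (1 + z ^+ (2 ^ l)%N).
Proof.
rewrite digit_sum_series //; congr (_ * _); apply: eq_bigr => l _.
have y1_neq0 : 1 - z ^+ (2 ^ l)%N != 0 by rewrite sub_neq0 ?expn_gt0.
have y2_neq0 : 1 - z ^+ (2 ^ l.+1)%N != 0 by rewrite sub_neq0 ?expn_gt0.
rewrite mulnC expnSr !exprM in y2_neq0 *.
have y1p_neq0 : 1 + z ^+ (2 ^ l)%N != 0.
  (* [1 + y] is a factor of the nonzero [1 - y^2], which also covers characteristic 2. *)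
  by move: y2_neq0; rewrite -{1}(expr1n K 2) subr_sqr mulf_eq0 => /norP[].
by field; apply/and3P.
Qed.

End DigitSumSeries.

(** The embedding of polynomials into fractions is injective, and ['X^n] has size [n.+1] while 1 has
    size 1. *)
Lemma fracX_exp_neq1 (F : fieldType) n : (0 < n)%N -> fracX F ^+ n != 1.
Proof.
move=> n_gt0; rewrite /fracX -rmorphXn -[1](rmorph1 (@tofrac {poly F})).
rewrite tofrac_eq; apply/eqP => /(congr1 (fun q : {poly F} => size q)).
by rewrite size_polyXn size_poly1 => -[n0]; rewrite n0 in n_gt0.
Qed.

Theorem theorem13 (F : fieldType) :
  let z : {fraction {poly F}} := fracX F in
  (forall b p : nat, (2 <= b)%N -> (1 <= p)%N ->
     \sum_(1 <= n < (b ^ p)%N) (digit_sum b n)%:R * z ^+ n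
     = (1 - z ^+ (b ^ p)%N) / (1 - z)
       * \sum_(0 <= l < p)
           (z ^+ (b ^ l)%N - b%:R * z ^+ (b ^ l.+1)%N
              + (b%:R - 1) * z ^+ ((b + 1) * b ^ l)%N)
           / ((1 - z ^+ (b ^ l)%N) * (1 - z ^+ (b ^ l.+1)%N)))
  /\ (forall p : nat, (1 <= p)%N ->
     \sum_(1 <= n < (2 ^ p)%N) (digit_sum 2 n)%:R * z ^+ n
     = (1 - z ^+ (2 ^ p)%N) / (1 - z)
       * \sum_(0 <= l < p) z ^+ (2 ^ l)%N / (1 + z ^+ (2 ^ l)%N)).
Proof.
by move=> z; split=> [b p b_gt1 _ | p _];
  [apply: digit_sum_series | apply: digit_sum_series2] => //;
  apply: fracX_exp_neq1.
Qed.
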